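(* There are absolute constants $c_1,C_1>0$ such that for every $d\in\mathbb N$, every finite nonempty set $Q\subset\mathbb Z^d$, every measurable set $B\subset\mathbb T^d$ with $|B|\le c_1|Q|^{-1}$, and every $f\in\mathcal T(Q)$, $$ \|f\|_{L_\infty(\mathbb T^d)}\le C_1|Q|^{1/2}\|f\|_{L_\infty(\mathbb T^d\setminus B)}. $$
   Context: $\mathbb T^d=[0,2\pi)^d$ (the $d$-dimensional torus), $|B|$ denotes the normalized Lebesgue measure $(2\pi)^{-d}\lambda(B)$ of $B$, and $|Q|$ is the cardinality of $Q$. $\mathcal T(Q)=\{f(\mathbf x)=\sum_{\mathbf k\in Q}c_{\mathbf k}e^{i(\mathbf k,\mathbf x)}: c_{\mathbf k}\in\mathbb C\}$. $\|f\|_{L_\infty(S)}=\sup_{\mathbf x\in S}|f(\mathbf x)|$. *)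

(* Defs.v *)
From mathcomp Require Import all_boot all_order all_algebra.
From mathcomp Require Import all_classical all_reals all_analysis.
From mathcomp Require Import complex.
Set Implicit Arguments. Unset Strict Implicit. Unset Printing Implicit Defensive.
Import Order.TTheory GRing.Theory Num.Theory.
Local Open Scope classical_set_scope.
Local Open Scope ring_scope.

Section Defs.
Variable R : realType.

Definition cabs (z : R[i]) : R :=
  let: Complex a b := z in Num.sqrt (a ^+ 2 + b ^+ 2).

Definition expi (t : R) : R[i] := Complex (cos t) (sin t).

Definition dotZR (d : nat) (k : {ffun 'I_d -> int}) (x : 'I_d -> R) : R :=
  \sum_(j < d) (k j)%:~R * x j.

Definition torus (d : nat) : set ('I_d -> R) :=
  [set x | forall j, 0 <= x j < 2 * pi].

(* T(Q): trigonometric polynomials with frequencies in Q (Q duplicate-free) *)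
Definition trig_poly (d : nat) (Q : seq {ffun 'I_d -> int})
  (f : ('I_d -> R) -> R[i]) : Prop :=
  exists c : {ffun 'I_d -> int} -> R[i],
    forall x, f x = \sum_(k <- Q) c k * expi (dotZR k x).

Definition box (d : nat) (a b : 'I_d -> R) : set ('I_d -> R) :=
  [set x | forall j, a j <= x j <= b j].
Definition box_vol (d : nat) (a b : 'I_d -> R) : R :=
  \prod_(j < d) Num.max 0 (b j - a j).

Definition leb_outer (d : nat) (A : set ('I_d -> R)) : \bar R :=
  ereal_inf [set s : \bar R | exists a b : nat -> 'I_d -> R,
     A `<=` \bigcup_n box (a n) (b n) /\
     s = (\sum_(0 <= n <oo) (box_vol (a n) (b n))%:E)%E].

Definition leb_measurable (d : nat) (A : set ('I_d -> R)) : Prop :=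
  caratheodory_measurable (@leb_outer d) A.

Definition norm_meas (d : nat) (B : set ('I_d -> R)) : \bar R :=
  (((2 * pi) ^+ d)^-1)%:E * leb_outer B.

Definition Linf_norm (d : nat) (S : set ('I_d -> R))
  (f : ('I_d -> R) -> R[i]) : \bar R :=
  ereal_sup [set (cabs (f x))%:E | x in S].

End Defs.

(* Main.v *)
Require Import Defs.
From mathcomp Require Import all_boot all_order all_algebra.
From mathcomp Require Import all_classical all_reals all_analysis.
From mathcomp Require Import complex.
From mathcomp Require Import ring lra.
Import Order.TTheory GRing.Theory Num.Theory numFieldNormedType.Exports.
Local Open Scope classical_set_scope.
Local Open Scope ring_scope.

(* Let n = |Q|, S = sum |c_k|^2, and suppose |f|^2 < s on the torus outside B.
   Since |f|^2 <= n S everywhere (Cauchy-Schwarz), S = ||f||_2^2 is at most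
   s + |B| n S, so that S <= 2 s as soon as |B| n <= 1/2, and |f|^2 <= 2 n s.
   Instead of integrals, averages over the grid (2 pi / N) {0, .., N-1}^d are
   used: Parseval is exact on the grid once N exceeds all differences of
   frequencies. The set {|f|^2 >= s} is compact and contained in B, hence covered
   by finitely many slightly enlarged boxes whose total volume is about |B|, and
   these contain at most a fraction of about |B| of the grid points when N is
   large. *)

(** * Complex exponentials and sums over roots of unity *)

Section Exponential.
Variable R : realType.
Implicit Types s t : R.

Lemma expi0 : expi (0 : R) = 1.
Proof. by rewrite /expi cos0 sin0. Qed.

Lemma expiD s t : expi (s + t) = expi s * expi t.
Proof. by rewrite /expi cosD sinD; simpc; congr Complex; ring. Qed.

Lemma expi_conj t : (expi t)^*%C = expi (- t).
Proof. by rewrite /expi cosN sinN. Qed.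

Lemma expi_mulrn t n : expi (t *+ n) = expi t ^+ n.
Proof.
elim: n => [|n IHn]; first by rewrite mulr0n expr0 expi0.
by rewrite mulrS exprS expiD IHn.
Qed.

Lemma expi_sum (I : Type) (r : seq I) (F : I -> R) :
  expi (\sum_(i <- r) F i) = \prod_(i <- r) expi (F i).
Proof. by rewrite (big_morph _ expiD expi0). Qed.

Lemma expi_2piMz (p : int) : expi (2 * pi * p%:~R : R) = 1.
Proof.
have expi2pi : expi (2 * pi : R) = 1.
  have -> : 2 * pi = pi *+ 2 :> R by rewrite mulr_natl.
  by rewrite expi_mulrn /expi cospi sinpi expr2; simpc.
have expin n : expi (2 * pi * n%:R : R) = 1.
  by rewrite mulr_natr expi_mulrn expi2pi expr1n.
case: (intP p) => [|n|n]; first by rewrite mulr0 expi0.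
  by rewrite -pmulrn.
by rewrite mulrNz mulrN -expi_conj -pmulrn expin conjc1.
Qed.

(** If [cos t = 1], the half-angle formula forces [sin (t / 2) = 0], whereas [|t| / 2] lies strictly
    between 0 and [pi], where the sine is positive. *)
Lemma expi_neq1 t : 0 < `|t| < 2 * pi -> expi t != 1.
Proof.
move=> /andP[t0 t2pi]; apply/eqP => -[cost _].
have : sin (`|t| / 2) != 0 by rewrite gt_eqF ?sin_gt0_pi //; lra.
have -> : (sin (`|t| / 2) != 0) = (sin (t / 2) != 0).
  by case: (ger0P t) => _ //; rewrite mulNr sinN oppr_eq0.
rewrite -sqrf_eq0 sin2cos2 => /eqP; apply.
have := cos_mulr2n (t / 2); have -> : t / 2 *+ 2 = t by lra.
by rewrite cost => h; lra.
Qed.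

(** A geometric sum whose ratio is an [N]-th root of unity; since 0 < |p| < N the ratio is not 1, so
    the sum vanishes. *)
Lemma sum_expi_roots (N : nat) (p : int) :
    p != 0 -> `|p|%:~R < N%:R :> R ->
  \sum_(m < N) expi (p%:~R * (2 * pi / N%:R * m%:R) : R) = 0.
Proof.
move=> p0 pN; have N0 : (0 : R) < N%:R.
  by rewrite (le_lt_trans _ pN) // ler0z normr_ge0.
set t : R := p%:~R * (2 * pi / N%:R).
have -> : \sum_(m < N) expi (p%:~R * (2 * pi / N%:R * m%:R) : R)
          = \sum_(m < N) expi t ^+ m.
  by apply: eq_bigr => m _; rewrite -expi_mulrn mulrA -(mulr_natr t).
have t1 : expi t != 1.
  have pi0 := pi_gt0 R; apply: expi_neq1; rewrite /t normrM -intr_norm.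
  rewrite (ger0_norm (_ : 0 <= 2 * pi / N%:R)); last first.
    by rewrite divr_ge0 ?ler0n ?mulr_ge0 ?pi_ge0.
  apply/andP; split.
    by rewrite mulr_gt0 ?divr_gt0 ?ltr0z ?normr_gt0 ?mulr_gt0.
  rewrite mulrCA gtr_pMr ?mulr_gt0 // -?ltr_pdivlMr ?invr_gt0 //.
  by rewrite invrK mul1r.
have tN : t *+ N = 2 * pi * p%:~R.
  by rewrite -(mulr_natr t) /t -[LHS]mulrA divfK ?gt_eqF // mulrC.
have /eqP := subrX1 (expi t) N.
by rewrite -expi_mulrn tN expi_2piMz subrr eq_sym mulf_eq0 subr_eq0 (negbTE t1) => /eqP.
Qed.

End Exponential.

(** * Moduli of complex numbers, followed by a Cauchy-Schwarz bound *)

Section ComplexModulus.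
Variable R : realType.
Implicit Types z : R[i].

Lemma cabs_ge0 z : 0 <= cabs z.
Proof. by case: z => a b; exact: sqrtr_ge0. Qed.

Lemma cabsE z : (cabs z)%:C%C = `|z|.
Proof. by rewrite normc_def; case: z. Qed.

Lemma cabs_sqr z : cabs z ^+ 2 = complex.Re z ^+ 2 + complex.Im z ^+ 2.
Proof. by case: z => a b; rewrite sqr_sqrtr // addr_ge0 ?sqr_ge0. Qed.

Lemma cabs_sqrC z : (cabs z ^+ 2)%:C%C = z * z^*%C.
Proof. by rewrite rmorphXn /= cabsE sqr_normc. Qed.

Lemma cabs_sum_expi (I : Type) (r : seq I) (c : I -> R[i]) (t : I -> R) :
  cabs (\sum_(k <- r) c k * expi (t k)) <= \sum_(k <- r) cabs (c k).
Proof.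
rewrite -lecR cabsE (le_trans (ler_norm_sum _ _ _)) // raddf_sum /=.
apply: ler_sum => k _; rewrite normrM cabsE ler_piMr ?normr_ge0 //.
by rewrite normc_def /= cos2Dsin2 sqrtr1.
Qed.

End ComplexModulus.

(** Cauchy-Schwarz against the constant 1: expanding the nonnegative sum of the [(n * a k - s) ^+ 2]
    gives [n * (n * q - s ^+ 2)]. The extra factor [n] makes the coefficient a square, positive as
    soon as [n] is nonzero. *)
Lemma sqr_sum_le (R : realFieldType) (I : Type) (r : seq I) (a : I -> R) :
  (\sum_(k <- r) a k) ^+ 2 <= (size r)%:R * \sum_(k <- r) a k ^+ 2.
Proof.
set s := \sum_(k <- r) a k; set q := \sum_(k <- r) _; set n : R := (size r)%:R.
have : 0 <= n * \sum_(k <- r) (n * a k - s) ^+ 2.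
  by rewrite mulr_ge0 ?ler0n // sumr_ge0 // => k _; exact: sqr_ge0.
have -> : \sum_(k <- r) (n * a k - s) ^+ 2 = n * (n * q - s ^+ 2).
  transitivity (\sum_(k <- r) (n ^+ 2 * a k ^+ 2 - 2 * n * s * a k + s ^+ 2)).
    by apply: eq_bigr => k _; ring.
  rewrite big_split sumrB -!mulr_sumr /= big_const_seq count_predT iter_addr_0.
  by rewrite -mulr_natr -/s -/q -/n; ring.
rewrite mulrA -(subr_ge0 (s ^+ 2)); have [n0|n0] := eqVneq n 0.
  have r0 : r = [::] by apply: size0nil; apply/eqP; rewrite -(pnatr_eq0 R) -/n n0.
  by rewrite /s /q r0 !big_nil expr0n /= mulr0 subr0.
by rewrite pmulr_rge0 // -expr2 exprn_even_gt0.
Qed.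

(** * Orthogonality of characters on the grid and discrete Parseval *)

Section Grid.
Variables (R : realType) (d N : nat).

Definition grid (i : {ffun 'I_d -> 'I_N}) : 'I_d -> R :=
  fun j => 2 * pi / N%:R * (i j)%:R.

Lemma grid_torus i : torus (grid i).
Proof.
move=> j; have := ltn_ord (i j); set m : nat := i j => mN.
have N0 : (0 : R) < N%:R by rewrite ltr0n (leq_trans _ mN).
have pi0 := pi_gt0 R.
rewrite /grid -/m mulr_ge0 ?divr_ge0 ?ler0n //=; last lra.
by rewrite mulrAC ltr_pdivrMr // ltr_pM2l ?ltr_nat //; lra.
Qed.

(** The sum over the grid factors into one-dimensional sums, and any coordinate where [k] and [l]
    differ contributes a factor 0. The bound by [N] excludes aliasing: distinct frequencies stay
    distinct modulo [N]. *)
Lemma sum_expi_grid (k l : {ffun 'I_d -> int}) :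
    (forall j, `|k j - l j|%:~R < N%:R :> R) ->
  \sum_(i : {ffun 'I_d -> 'I_N}) expi (dotZR k (grid i)) * (expi (dotZR l (grid i)))^*%C
  = (N%:R ^+ d) *+ (k == l).
Proof.
move=> klN.
transitivity (\prod_(j < d) \sum_(m < N)
    expi ((k j - l j)%:~R * (2 * pi / N%:R * m%:R) : R)).
  rewrite bigA_distr_bigA; apply: eq_bigr => i _.
  rewrite expi_conj -expiD -expi_sum; congr expi.
  by rewrite -sumrB; apply: eq_bigr => j _; rewrite intrB mulrBl.
have [->|kl] := eqVneq k l.
  under eq_bigr => j _ do under eq_bigr => m _ do rewrite subrr mul0r expi0.
  by rewrite prodr_const sumr_const !card_ord.
have /existsP[j kj] : [exists j, k j != l j].
  rewrite -negb_forall; apply: contra kl => /forallP e.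
  by apply/eqP/ffunP => j; exact/eqP.
by rewrite mulr0n (bigD1 j) //= sum_expi_roots ?subr_eq0 ?mul0r.
Qed.

(** Writing the squared modulus as [z] times its conjugate gives a double sum over [Q];
    orthogonality leaves the diagonal, where [uniq Q] ensures that each frequency meets only
    itself. *)
Lemma grid_parseval (Q : seq {ffun 'I_d -> int}) (c : {ffun 'I_d -> int} -> R[i]) :
    uniq Q ->
    (forall k l, k \in Q -> l \in Q -> forall j, `|k j - l j|%:~R < N%:R :> R) ->
  \sum_(i : {ffun 'I_d -> 'I_N}) cabs (\sum_(k <- Q) c k * expi (dotZR k (grid i))) ^+ 2
  = N%:R ^+ d * \sum_(k <- Q) cabs (c k) ^+ 2.
Proof.
move=> uQ QN; apply: (@complexI R); rewrite rmorphM rmorphXn rmorph_nat /= !raddf_sum /=.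
under eq_bigr => i _ do rewrite cabs_sqrC rmorph_sum mulr_suml.
rewrite exchange_big mulr_sumr /=; apply: eq_big_seq => k kQ.
under eq_bigr => i _ do rewrite mulr_sumr.
rewrite exchange_big /= (bigD1_seq k) //= [X in _ + X]big1_seq ?addr0 => [|l /andP[lk lQ]].
  rewrite cabs_sqrC mulrC.
  under eq_bigr => i _ do rewrite rmorphM /= mulrACA.
  by rewrite -mulr_sumr sum_expi_grid ?eqxx // => j; exact: QN.
under eq_bigr => i _ do rewrite rmorphM /= mulrACA.
rewrite -mulr_sumr sum_expi_grid ?(eq_sym k) ?(negbTE lk) ?mulr0 // => j.
exact: QN.
Qed.

End Grid.

Arguments grid {R d N} i j.

(** * Counting grid points in boxes and in compact sets *)

Section Counting.
Variable R : realType.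

(** A closed interval of length L contains at most L / h + 1 multiples of [h]. The induction removes
    the multiple 0 and shifts the interval by [h]. *)
Lemma progression_count (h a b : R) (N : nat) : 0 < h ->
  h * \sum_(m < N) (a <= h * m%:R <= b)%R%:R <= Num.max 0 (b - a) + h.
Proof.
move=> h0; elim: N a b => [|N IHN] a b.
  by rewrite big_ord0 mulr0 addr_ge0 ?le_max ?lexx // ltW.
have shift m : (a <= h * (bump 0 m)%:R <= b) = (a - h <= h * m%:R <= b - h).
  by rewrite /bump /= natrD mulrDr mulr1 lerBlDr lerBrDr addrC.
rewrite big_ord_recl /= mulr0.
under eq_bigr => m _ do rewrite shift.
(* When 0 is not in the interval, nothing is lost by shifting, as the length is unchanged. *)
have [ab|_] := boolP (a <= 0 <= b); last first.
  have -> : b - a = b - h - (a - h) by ring.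
  by rewrite add0r IHN.
have [a0 b0] := andP ab.
have -> : Num.max 0 (b - a) = b - a by apply: max_r; lra.
rewrite [X in h * (X + _)](_ : _ = 1) //.
have [bh|hb] := ltP b h.
  rewrite big1 ?addr0 => [|m _]; first by lra.
  have := ler0n R m => m0; rewrite [_ <= b - h]leNgt (_ : _ < _) ?andbF //.
  by rewrite (@lt_le_trans _ _ 0) ?mulr_ge0 // ?ltW //; lra.
(* Keeping the left end [a - h] would leave the length at [b - a] and lose the [h] spent on the
   multiple 0. Raising it to 0 discards no multiple and shortens the interval to [b - h]. *)
have le0 : h * \sum_(m < N) (a - h <= h * m%:R <= b - h)%R%:R <=
           h * \sum_(m < N) (0 <= h * m%:R <= b - h)%R%:R.
  rewrite ler_wpM2l ?(ltW h0) // ler_sum // => m _.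
  by rewrite mulr_ge0 ?(ltW h0) // ler_nat; case: (_ <= _).
by have := le_trans le0 (IHN _ _); rewrite subr0 max_r ?mulrDr; lra.
Qed.

(** Membership in a box is a product of coordinatewise conditions, so the count is a product of
    one-dimensional counts. *)
Lemma box_grid_count (d N : nat) (a b : 'I_d -> R) : (0 < N)%N ->
  (2 * pi / N%:R) ^+ d *
    \sum_(i : {ffun 'I_d -> 'I_N}) (`[< box a b (grid i) >])%:R
  <= \prod_(j < d) (Num.max 0 (b j - a j) + 2 * pi / N%:R).
Proof.
move=> N0; set h : R := 2 * pi / N%:R.
have h0 : 0 < h by rewrite divr_gt0 ?mulr_gt0 ?pi_gt0 ?ltr0n.
apply: (@le_trans _ _
  (\prod_(j < d) (h * \sum_(m < N) (a j <= h * m%:R <= b j)%R%:R))).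
  rewrite big_split /= prodr_const card_ord ler_wpM2l ?exprn_ge0 ?(ltW h0) //.
  rewrite bigA_distr_bigA /= ler_sum // => i _.
  case: asboolP => [abi|_]; last by rewrite prodr_ge0 // => j _; rewrite ler0n.
  by rewrite big1 // => j _; rewrite (abi j).
apply: ler_prod => j _; rewrite progression_count // mulr_ge0 ?(ltW h0) //.
by rewrite sumr_ge0 // => m _; rewrite ler0n.
Qed.

(** The product is a polynomial in [x], hence continuous at 0. *)
Lemma prod_shift_le (d : nat) (w : 'I_d -> R) (e : R) : 0 < e ->
  exists2 x : R, 0 < x & \prod_(j < d) (w j + x) <= \prod_(j < d) w j + e.
Proof.
move=> e0; pose p : {poly R} := \prod_(j < d) ((w j)%:P + 'X).
have pE x : p.[x] = \prod_(j < d) (w j + x).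
  by rewrite horner_prod; apply: eq_bigr => j _; rewrite !hornerE.
have /cvgrPdist_le/(_ _ e0) : p.[x] @[x --> (0 : R)] --> p.[0].
  exact: continuous_horner.
move=> /nbhs_ballP[r /= r0 rP]; exists (r / 2); first by rewrite divr_gt0.
have /rP : ball (0 : R) r (r / 2).
  by rewrite /ball /= sub0r normrN gtr0_norm ?divr_gt0 //; lra.
rewrite !pE distrC => /(le_trans (ler_norm _)); rewrite lerBlDl.
by under [\prod_(j < d) (w j + 0)]eq_bigr => j _ do rewrite addr0.
Qed.

Lemma sum_geo_half_le (e : R) (m : nat) : 0 <= e ->
  \sum_(n < m) e / 2 ^+ n.+1 <= e.
Proof.
move=> e0; have -> : \sum_(n < m) e / 2 ^+ n.+1 = e - e / 2 ^+ m.
  elim: m => [|m IHm]; first by rewrite big_ord0 expr0 divr1 subrr.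
  by rewrite big_ord_recr /= IHm exprS invfM; lra.
by rewrite gerBl divr_ge0 // exprn_ge0.
Qed.

Lemma near_step_le (e : R) : 0 < e ->
  \forall N \near \oo, (0 < N)%N /\ 2 * pi / N%:R <= e :> R.
Proof.
move=> e0; near=> N.
have N0 : (0 < N)%N by near: N; exact: nbhs_infty_gt.
split=> //; rewrite ler_pdivrMr ?ltr0n // [e * _]mulrC -ler_pdivrMr //.
by near: N; exact: nbhs_infty_ger.
Unshelve. all: by end_near. Qed.

Lemma open_box_open (d : nat) (a b : 'I_d -> R) :
  open [set v : 'rV[R]_d | forall j, a j < v ord0 j < b j].
Proof.
rewrite openE => v abv.
suff: \forall u \near v, forall j, a j < (u : 'rV[R]_d) ord0 j < b j by [].
apply: (@filter_forall _ _ (fun j (u : 'rV[R]_d) => a j < u ord0 j < b j) _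
  (nbhs_filter v)) => j.
have cvj : {for v, continuous (fun u : 'rV[R]_d => u ord0 j)}.
  exact: coord_continuous.
have : nbhs (v ord0 j) (`]a j, b j[%classic).
  by apply: open_nbhs_nbhs; split; [exact: itv_open|rewrite /= in_itv /= abv].
by move=> /cvj; apply: (@filterS _ _ (nbhs_filter v)) => u /=; rewrite in_itv.
Qed.

(** Each box is enlarged to an open one, compactness leaves finitely many, and the grid points are
    counted box by box. Points are read as row vectors because the topology lives on ['rV[R]_d]. *)
Lemma compact_grid_count (d : nat) (a b : nat -> 'I_d -> R)
    (K : set ('I_d -> R)) (V e : R) :
    compact [set v : 'rV[R]_d | K (v ord0)] ->
    K `<=` \bigcup_n box (a n) (b n) ->
    (forall m, \sum_(n < m) box_vol (a n) (b n) <= V) -> 0 < e ->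
  \forall N \near \oo, (2 * pi / N%:R) ^+ d *
    \sum_(i : {ffun 'I_d -> 'I_N}) (`[< K (grid i) >])%:R <= V + e.
Proof.
move=> cK Kab abV e0.
(* The margin [3 * x] per side pays for the enlargement by [x] at both ends and for one grid step,
   itself at most [x] later on. The errors [e / 2 ^+ n.+1] add up to at most [e]. *)
have /choice[x xP] : forall n, exists x, 0 < x /\
    \prod_(j < d) (Num.max 0 (b n j - a n j) + 3 * x)
      <= box_vol (a n) (b n) + e / 2 ^+ n.+1.
  move=> n; have [|x x0 xle] := @prod_shift_le d
    (fun j => Num.max 0 (b n j - a n j)) (e / 2 ^+ n.+1).
    by rewrite divr_gt0 ?exprn_gt0.
  exists (x / 3); split; first by rewrite divr_gt0.
  by rewrite mulrC divfK ?pnatr_eq0.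
pose O n := [set v : 'rV[R]_d |
  forall j, a n j - x n < v ord0 j < b n j + x n].
move: cK; rewrite compact_cover => /(_ nat setT O) [].
- by move=> n _; exact: open_box_open.
- move=> v /Kab[n _ abn]; exists n => // j; have /andP[av vb] := abn j.
  by have [x0 _] := xP n; apply/andP; split; lra.
(* The finite subcover is replaced by all boxes of index below [m]; the successor also makes ['I_m]
   inhabited, so that [ord0] can be used below. *)
move=> D _ KD; pose m := (\max_(n <- finmap.enum_fset D) n).+1.
have Km v : K v -> exists n : 'I_m,
    box (fun j => a n j - x n) (fun j => b n j + x n) v.
  move=> Kv; have [|n nD Ov] := KD (\row_j v j).
    by rewrite /= (_ : (\row_j v j) ord0 = v) //; apply/funext => j; rewrite mxE.
  have nm : (n < m)%N by rewrite ltnS (@leq_bigmax_seq _ _ xpredT id).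
  exists (Ordinal nm) => j /=; have := Ov j; rewrite mxE => /andP[? ?].
  by apply/andP; split; exact: ltW.
near=> N.
have NP : forall n : 'I_m, (0 < N)%N /\ 2 * pi / N%:R <= x n.
  near: N; apply: filter_forall => n; apply: near_step_le.
  by have [] := xP n.
have [N0 _] := NP ord0.
apply: (@le_trans _ _ (\sum_(n < m) (box_vol (a n) (b n) + e / 2 ^+ n.+1))).
  apply: (@le_trans _ _ (\sum_(n < m) ((2 * pi / N%:R) ^+ d *
      \sum_(i : {ffun 'I_d -> 'I_N})
        (`[< box (fun j => a n j - x n) (fun j => b n j + x n) (grid i) >])%:R))).
    rewrite -mulr_sumr ler_wpM2l ?exprn_ge0 ?divr_ge0 ?mulr_ge0 ?pi_ge0 //.
    rewrite exchange_big ler_sum //= => i _.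
    case: (asboolP (K _)) => [/Km[n nP]|_]; last by rewrite sumr_ge0.
    by rewrite (bigD1 n) //= asboolT // lerDl sumr_ge0.
  apply: ler_sum => n _; have [_ Nx] := NP n; have [x0 xle] := xP n.
  apply: le_trans xle; apply: le_trans (box_grid_count _ _ _ _ N0) _.
  have h0 : 0 <= 2 * pi / N%:R :> R by rewrite divr_ge0 ?mulr_ge0 ?pi_ge0.
  apply: ler_prod => j _; rewrite addr_ge0 ?le_max ?lexx //=.
  have : Num.max 0 (b n j + x n - (a n j - x n))
         <= Num.max 0 (b n j - a n j) + 2 * x n.
    by rewrite ge_max; apply/andP; split; case: (lerP 0 (b n j - a n j)); lra.
  lra.
rewrite big_split /= lerD ?abV //; apply: sum_geo_half_le; exact: ltW.
Unshelve. all: by end_near. Qed.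

End Counting.

(** * From outer measure to the proportion of grid points *)

Section Remez.
Variable R : realType.

Lemma box_vol_ge0 (d : nat) (a b : 'I_d -> R) : 0 <= box_vol a b.
Proof. by rewrite prodr_ge0 // => j _; rewrite le_max lexx. Qed.

(** The infimum need not be attained, hence the strict inequality. Partial sums stay below the
    series because volumes are nonnegative. *)
Lemma leb_outer_cover (d : nat) (B : set ('I_d -> R)) (V : R) :
    (leb_outer B < V%:E)%E ->
  exists a b : nat -> 'I_d -> R, B `<=` \bigcup_n box (a n) (b n) /\
    forall m, \sum_(n < m) box_vol (a n) (b n) <= V.
Proof.
move=> /ereal_inf_lt[_ [a [b [Bab ->]]] sV]; exists a, b; split=> // m.
rewrite -lee_fin -sumEFin; apply: le_trans (ltW sV).
rewrite -(big_mkord xpredT (fun n => (box_vol (a n) (b n))%:E)).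
by apply: nneseries_lim_ge => n _ _; rewrite lee_fin box_vol_ge0.
Qed.

(* [compact_grid_count] is applied to the closed cube, which is compact; the faces
   [x_j = 2 pi], not covered by [B], lie in [d] additional boxes of volume 0. *)
Lemma torus_grid_count (d : nat) (B : set ('I_d -> R)) (V s e : R)
    (g : ('I_d -> R) -> R) :
    (leb_outer B < V%:E)%E ->
    continuous (fun v : 'rV[R]_d => g (v ord0)) ->
    (forall x, torus x -> s <= g x -> B x) -> 0 < e ->
  \forall N \near \oo, (2 * pi / N%:R) ^+ d *
    \sum_(i : {ffun 'I_d -> 'I_N}) (s <= g (grid i))%R%:R <= V + e.
Proof.
move=> /leb_outer_cover[a [b [Bab abV]]] cg gB e0.
pose K : set ('I_d -> R) := [set x | (forall j, 0 <= x j <= 2 * pi) /\ s <= g x].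
pose a' n : 'I_d -> R := if (n < d)%N then fun j : 'I_d =>
  if j == n :> nat then 2 * pi else 0 else a (n - d)%N.
pose b' n : 'I_d -> R := if (n < d)%N then fun=> 2 * pi else b (n - d)%N.
have ltDn n : (d + n < d)%N = false by rewrite ltnNge leq_addr.
have KN : \forall N \near \oo, (2 * pi / N%:R) ^+ d *
    \sum_(i : {ffun 'I_d -> 'I_N}) (`[< K (grid i) >])%:R <= V + e.
  apply: (@compact_grid_count _ _ a' b' K V e _ _ _ e0).
  - have -> : [set v : 'rV[R]_d | K (v ord0)] =
        [set v : 'rV[R]_d | forall j, `[0, 2 * pi]%classic (v ord0 j)] `&`
        (fun v : 'rV[R]_d => g (v ord0)) @^-1` [set y | s <= y].
      by apply/seteqP; split=> v [vj sv]; split=> // j; have := vj j;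
         rewrite /= in_itv.
    apply: compact_closedI.
      apply: (@rV_compact _ d (fun=> `[0, 2 * pi]%classic)) => j.
      exact: segment_compact.
    apply: preimage_closed; last exact: closed_ge.
    by move=> v _; exact: cg.
  - move=> x [x2pi sx]; have [xT|/existsNP[j0 xj0]] := pselect (torus x).
      have [n _ abn] := Bab _ (gB _ xT sx); exists (d + n)%N => //.
      by rewrite /a' /b' ltDn addKn.
    exists (val j0) => //; rewrite /a' /b' ltn_ord => j; have := x2pi j.
    case: eqP => [/val_inj->|_] // /andP[x0 x2]; rewrite x2 andbT leNgt.
    by apply/negP => xlt; apply: xj0; rewrite x0.
  - move=> m; apply: le_trans (abV m).
    have abS n : box_vol (a' (d + n)%N) (b' (d + n)%N) = box_vol (a n) (b n).
      by rewrite /a' /b' ltDn addKn.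
    under [leRHS]eq_bigr => n _ do rewrite -abS.
    (* The sum is extended to [d + m] terms: the first [d], the faces, vanish, and the rest are the
       first [m] boxes of the cover of [B]. *)
    apply: (@le_trans _ _ (\sum_(n < d + m) box_vol (a' n) (b' n))).
      rewrite -!(big_mkord xpredT (fun n => box_vol (a' n) (b' n))).
      rewrite (@big_cat_nat _ _ _ m _ (d + m)) ?leq_addl //= lerDl.
      by rewrite sumr_ge0 // => n _; exact: box_vol_ge0.
    rewrite big_split_ord /= gerDr big1 // => j _.
    by rewrite /box_vol (bigD1 j) //= /a' /b' ltn_ord eqxx subrr maxxx mul0r.
apply: filterS KN => N; apply: le_trans.
rewrite ler_wpM2l ?exprn_ge0 ?divr_ge0 ?mulr_ge0 ?pi_ge0 // ler_sum // => i _.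
rewrite ler_nat; case: leP => // sg; rewrite asboolT //; split=> // j.
by have /andP[-> /ltW ->] := grid_torus R d N i j.
Qed.

(** * Trigonometric polynomials that are large only inside a small set *)

Section Polynomial.
Variables (d : nat) (Q : seq {ffun 'I_d -> int}) (c : {ffun 'I_d -> int} -> R[i]).

Let f (x : 'I_d -> R) := \sum_(k <- Q) c k * expi (dotZR k x).

(** Real and imaginary parts are explicit finite sums of cosines and sines. The parametrization [x]
    allows points to be given by row vectors. *)
Lemma cabs_sqr_continuous (T : topologicalType) (x : T -> 'I_d -> R) :
    (forall j, continuous (fun v => x v j)) ->
  continuous (fun v => cabs (f (x v)) ^+ 2).
Proof.
move=> cx; have cdot k : continuous (fun v => dotZR k (x v)).
  move=> v; apply: cvg_big => [|j _]; first exact: add_continuous.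
  by apply: cvgMr; exact: cx.
have ccos k v : cos (dotZR k (x u)) @[u --> v] --> cos (dotZR k (x v)).
  by apply: (continuous_comp (cdot k v)); exact: continuous_cos.
have csin k v : sin (dotZR k (x u)) @[u --> v] --> sin (dotZR k (x v)).
  by apply: (continuous_comp (cdot k v)); exact: continuous_sin.
have ReE y : complex.Re (f y) = \sum_(k <- Q)
    (complex.Re (c k) * cos (dotZR k y) - complex.Im (c k) * sin (dotZR k y)).
  by rewrite /f raddf_sum; apply: eq_bigr => k _; case: (c k).
have ImE y : complex.Im (f y) = \sum_(k <- Q)
    (complex.Re (c k) * sin (dotZR k y) + complex.Im (c k) * cos (dotZR k y)).
  by rewrite /f raddf_sum; apply: eq_bigr => k _; case: (c k).
have cRe v : complex.Re (f (x u)) @[u --> v] --> complex.Re (f (x v)).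
  under eq_fun => u do rewrite ReE.
  rewrite ReE; apply: cvg_big => [|k _]; first exact: add_continuous.
  by apply: cvgB; apply: cvgMr; [exact: ccos|exact: csin].
have cIm v : complex.Im (f (x u)) @[u --> v] --> complex.Im (f (x v)).
  under eq_fun => u do rewrite ImE.
  rewrite ImE; apply: cvg_big => [|k _]; first exact: add_continuous.
  by apply: cvgD; apply: cvgMr; [exact: csin|exact: ccos].
move=> v; under eq_fun => u do rewrite cabs_sqr !expr2.
by apply: cvgD; apply: cvgM; (exact: cRe || exact: cIm).
Qed.

Lemma cabs_sqr_le (x : 'I_d -> R) :
  cabs (f x) ^+ 2 <= (size Q)%:R * \sum_(k <- Q) cabs (c k) ^+ 2.
Proof.
apply: le_trans (sqr_sum_le _ _ _ _).
by rewrite lerXn2r ?nnegrE ?sumr_ge0 ?cabs_ge0 ?cabs_sum_expi // => k _; exact: cabs_ge0.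
Qed.

Lemma near_frequencies_lt : \forall N \near \oo,
  forall k l, k \in Q -> l \in Q -> forall j, `|k j - l j|%:~R < N%:R :> R.
Proof.
pose M := \max_(k <- Q) \max_(l <- Q) \max_(j < d) `|k j - l j|%N.
have kM : forall k l, k \in Q -> l \in Q -> forall j, (`|k j - l j| <= M)%N.
  move=> k l kQ lQ j; apply: leq_trans (leq_bigmax_seq _ kQ isT).
  by apply: leq_trans (leq_bigmax_seq _ lQ isT); apply: leq_bigmax.
near=> N => k l kQ lQ j; rewrite -natr_absz ltr_nat (leq_ltn_trans (kM _ _ kQ lQ j)) //.
by near: N; exact: nbhs_infty_gt.
Unshelve. all: by end_near. Qed.

Lemma remez_sqr (B : set ('I_d -> R)) (V s : R) :
    uniq Q -> Q != [::] ->
    (leb_outer B < V%:E)%E -> V < (2 * pi) ^+ d / (2 * (size Q)%:R) ->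
    0 <= s -> (forall x, torus x -> s <= cabs (f x) ^+ 2 -> B x) ->
  forall x, cabs (f x) ^+ 2 <= 2 * (size Q)%:R * s.
Proof.
move=> uQ Q0 BV Vlt s0 sB x; set n : R := (size Q)%:R.
have n0 : 0 < n by rewrite ltr0n lt0n size_eq0.
set S := \sum_(k <- Q) cabs (c k) ^+ 2.
have S0 : 0 <= S by rewrite sumr_ge0 // => k _; exact: sqr_ge0.
suff SS : S <= 2 * s.
  rewrite (le_trans (cabs_sqr_le x)) // -/n -/S [2 * n]mulrC -mulrA.
  by rewrite ler_wpM2l // ltW.
(* With this error term, [V + e] is exactly [(2 * pi) ^+ d / (2 * n)], so at most a fraction 1 /
   (2n) of the grid points is bad. *)
have e0 : 0 < (2 * pi) ^+ d / (2 * n) - V by rewrite subr_gt0.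
have bad := torus_grid_count _ _ _ s _ _ BV
  (cabs_sqr_continuous _ (fun v : 'rV[R]_d => v ord0)
    (fun j => @coord_continuous R 1 d ord0 j)) sB e0.
near \oo => N.
have N0 : (0 < N)%N by near: N; exact: nbhs_infty_gt.
have freqN : forall k l, k \in Q -> l \in Q ->
    forall j, `|k j - l j|%:~R < N%:R :> R.
  by near: N; exact: near_frequencies_lt.
pose bads := \sum_(i : {ffun 'I_d -> 'I_N}) (s <= cabs (f (grid i)) ^+ 2)%R%:R : R.
have badsN : 2 * n * bads <= N%:R ^+ d.
  have : (2 * pi / N%:R) ^+ d * bads <= V + ((2 * pi) ^+ d / (2 * n) - V).
    by rewrite /bads; near: N; exact: bad.
  have pi0 : 0 < (2 * pi : R) ^+ d by rewrite exprn_gt0 ?mulr_gt0 ?pi_gt0.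
  rewrite addrC subrK expr_div_n -!mulrA ler_pM2l //.
  by rewrite ler_pdivrMl ?exprn_gt0 ?ltr0n // ler_pdivlMr ?mulr_gt0 // mulrC mulrA.
have Nd0 : 0 < N%:R ^+ d :> R by rewrite exprn_gt0 ?ltr0n.
(* In the Parseval sum, good points contribute at most [s] and bad points at most [n * S]. *)
have : N%:R ^+ d * S <= N%:R ^+ d * s + bads * (n * S).
  rewrite -(grid_parseval R d N Q c uQ freqN).
  have -> : N%:R ^+ d * s = \sum_(i : {ffun 'I_d -> 'I_N}) s.
    by rewrite sumr_const card_ffun !card_ord -(mulr_natl s) natrX.
  rewrite /bads mulr_suml -big_split ler_sum //= => i _; rewrite -/(f _).
  case: (leP s) => [_|/ltW fs]; last by rewrite mulr0n mul0r addr0.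
  by rewrite mulr1n mul1r (le_trans (cabs_sqr_le _)) // lerDr.
(* The bad points account for at most half of the left-hand side, and this half is absorbed. *)
move=> h; rewrite -(ler_pM2l Nd0).
have : 2 * (bads * (n * S)) <= N%:R ^+ d * S.
  by rewrite (_ : _ * _ = 2 * n * bads * S) ?ler_wpM2r //; ring.
have -> : N%:R ^+ d * (2 * s) = 2 * (N%:R ^+ d * s) by ring.
by move: h; set p := _ ^+ d * S; set q := _ ^+ d * s; set r := bads * _; lra.
Unshelve. all: by end_near. Qed.

End Polynomial.

(** If [B] contained the torus, [remez_sqr] for the constant polynomial 1 would apply with [s = 0]
    and give 1 <= 0. This keeps the supremum outside [B] from being taken over the empty set. *)
Lemma torus_nsubset (d : nat) (B : set ('I_d -> R)) (V : R) :
  (leb_outer B < V%:E)%E -> V < (2 * pi) ^+ d / 2 -> exists2 x, torus x & ~ B x.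
Proof.
move=> BV Vlt; apply: contrapT => TB.
pose k0 : {ffun 'I_d -> int} := [ffun=> 0].
have allB x : torus x -> B x.
  by move=> xT; apply: contrapT => nB; apply: TB; exists x.
have := remez_sqr d [:: k0] (fun=> 1) B V 0 isT isT BV; rewrite mulr1.
move=> /(_ Vlt (lexx 0) (fun x xT _ => allB x xT) (fun=> 0)).
by rewrite big_seq1 mul1r mulr0 cabs_sqr /= cos2Dsin2 leNgt ltr01.
Qed.

End Remez.

(** * Choice of constants and passage to suprema *)

Theorem theorem5p2 (R : realType) :
  exists c1 C1 : R, 0 < c1 /\ 0 < C1 /\
  forall (d : nat) (Q : seq {ffun 'I_d -> int})
         (B : set ('I_d -> R)) (f : ('I_d -> R) -> R[i]),
    (0 < d)%N ->
    uniq Q -> Q != [::] ->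
    B `<=` @torus R d -> leb_measurable B ->
    (norm_meas B <= (c1 / (size Q)%:R)%:E)%E ->
    trig_poly Q f ->
    (Linf_norm (@torus R d) f
       <= (C1 * Num.sqrt (size Q)%:R)%:E * Linf_norm (@torus R d `\` B) f)%E.
Proof.
exists (1 / 4), 2; split; first by rewrite divr_gt0.
split=> // d Q B f _ uQ Q0 _ _ Bc [c fE].
set n : R := (size Q)%:R; have n1 : 1 <= n by rewrite ler1n lt0n size_eq0.
have n0 : 0 < n by exact: lt_le_trans n1.
have pi0 : 0 < (2 * pi : R) ^+ d by rewrite exprn_gt0 ?mulr_gt0 ?pi_gt0.
(* The factor 1/3 lies strictly between [c1 = 1/4] and the threshold 1/2 of [remez_sqr], giving both
   strict inequalities. *)
pose V := (2 * pi) ^+ d * (1 / 3 / n).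
have BV : (leb_outer B < V%:E)%E.
  apply: (@le_lt_trans _ _ ((2 * pi) ^+ d * (1 / 4 / n))%:E).
    by rewrite EFinM -lee_pdivrMl // ?EFinM.
  rewrite lte_fin ltr_pM2l // ltr_pM2r ?invr_gt0 //; lra.
have Vlt : V < (2 * pi) ^+ d / (2 * n).
  rewrite ltr_pM2l // invfM ltr_pM2r ?invr_gt0 //; lra.
have [x0 x0T nBx0] : exists2 x, torus x & ~ B x.
  apply: torus_nsubset _ _ _ _ BV (lt_le_trans Vlt _).
  rewrite ler_pM2l // lef_pV2 ?posrE ?mulr_gt0 //; lra.
have C0 : 0 < 2 * Num.sqrt n by rewrite mulr_gt0 ?sqrtr_gt0.
have le_norm x : torus x -> ~ B x -> ((cabs (f x))%:E <= Linf_norm (@torus R d `\` B) f)%E.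
  by move=> xT nBx; apply: ereal_sup_ubound; exists x.
(* The value [-oo] is excluded by the point [x0] outside [B], and for [+oo] the bound is trivial
   since the constant is positive. *)
case ME : (Linf_norm _ f) (le_norm) => [M| |] leM; last first.
- by have := leM _ x0T nBx0.
- by rewrite gt0_muley ?lte_fin // leey.
apply: ge_ereal_sup => _ [x xT <-]; rewrite -EFinM lee_fin leNgt; apply/negP => ltf.
have M0 : 0 <= M by have := leM _ x0T nBx0; rewrite lee_fin; apply: le_trans (cabs_ge0 _ _).
(* If the bound fails at [x], this level is strictly above [M], so [|f|] can reach it on the torus
   only inside [B]. *)
pose M' := cabs (f x) / (2 * Num.sqrt n).
have MM' : M < M' by rewrite ltr_pdivlMr // mulrC.
have M'B y : torus y -> M' ^+ 2 <= cabs (\sum_(k <- Q) c k * expi (dotZR k y)) ^+ 2 -> B y.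
  rewrite -fE ler_sqr ?nnegrE ?cabs_ge0 ?(le_trans M0 (ltW MM')) // => yT M'f.
  apply: contrapT => nBy; have := leM _ yT nBy; rewrite lee_fin => fM.
  by have := lt_le_trans MM' (le_trans M'f fM); rewrite ltxx.
have := remez_sqr R d Q c B V (M' ^+ 2) uQ Q0 BV Vlt (sqr_ge0 _) M'B x.
rewrite -fE.
(* Now the squared modulus at [x] equals [4 * n * M' ^+ 2], whereas [remez_sqr] bounds it by
   [2 * n * M' ^+ 2]; this is absurd because [M'] is positive. *)
have -> : cabs (f x) = M' * (2 * Num.sqrt n) by rewrite divfK ?gt_eqF.
have M'0 : 0 < M' by exact: le_lt_trans MM'.
rewrite -/n exprMn [(2 * _) ^+ 2]exprMn sqr_sqrtr ?(ltW n0) //.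
have : 0 < M' ^+ 2 * n by rewrite mulr_gt0 ?exprn_gt0.
lra.
Qed.
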